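(* For all probability distributions $P$ and $Q$ on $\mathsf Z$, $$|H_{\mathsf A,\ell}(P)-H_{\mathsf A,\ell}(Q)|\le d_{\mathsf A,\ell}(P,Q),$$ where $d_{\mathsf A,\ell}(P,Q)=\sup_{a\in\mathsf A}\big|\mathbb E_P[\ell(Z,a)]-\mathbb E_Q[\ell(Z,a)]\big|$.
   Context: $\mathsf Z$ is a (measurable) space of outcomes, $\mathsf A$ a space of actions, $\ell:\mathsf Z\times\mathsf A\to\mathbb R$ a loss function. The generalized entropy of a distribution $P$ on $\mathsf Z$ is $H_{\mathsf A,\ell}(P)=\inf_{a\in\mathsf A}\mathbb E_P[\ell(Z,a)]$, $Z\sim P$. It is assumed that this infimum is attained for all distributions considered and that the expectations involved are well defined. *)

(* Defs.v *)
From mathcomp Require Import all_boot all_order all_algebra.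
From mathcomp Require Import all_classical all_reals all_analysis.

Set Implicit Arguments.
Unset Strict Implicit.
Unset Printing Implicit Defensive.

Import Order.TTheory GRing.Theory Num.Theory.
Import numFieldNormedType.Exports.

Local Open Scope classical_set_scope.
Local Open Scope ring_scope.
Local Open Scope ereal_scope.

Section GeneralizedEntropy.
Context {d : measure_display} {Z : measurableType d} {R : realType}.

(* 'E_P[X] is the integral of the positive part minus that of the negative
   part; [x +? y] says that x + y is not of the form +oo - oo.  The
   expectation may be infinite, as long as it is not of that form. *)
Definition has_expectation (P : probability Z R) (X : Z -> R) : Prop :=
  measurable_fun [set: Z] X /\
  (\int[P]_z (EFin \o X)^\+ z) +? - (\int[P]_z (EFin \o X)^\- z).

Definition gen_entropy (A : Type) (l : Z -> A -> R) (P : probability Z R) :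
    \bar R :=
  ereal_inf [set 'E_P[l^~ a] | a in [set: A]].

Definition entropy_attained (A : Type) (l : Z -> A -> R)
    (P : probability Z R) : Prop :=
  exists a : A, 'E_P[l^~ a] = gen_entropy l P.

Definition loss_dist (A : Type) (l : Z -> A -> R) (P Q : probability Z R) :
    \bar R :=
  ereal_sup [set `|'E_P[l^~ a] - 'E_Q[l^~ a]| | a in [set: A]].

End GeneralizedEntropy.

(* Main.v *)
(* If a minimizes the P-risk and H(P) <= H(Q), then
   H(P) = E_P[l(Z,a)] <= H(Q) <= E_Q[l(Z,a)], so the gap of the entropies is at
   most the gap of the risks at a.  The other case is symmetric. *)
Require Import Defs.
From mathcomp Require Import all_boot all_order all_algebra.
From mathcomp Require Import all_classical all_reals all_analysis.

Local Open Scope ring_scope.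
Local Open Scope ereal_scope.

Import Order.TTheory GRing.Theory Num.Theory.

(** An infimum is 1-Lipschitz for the sup distance: at an action optimal for the distribution of
    smaller entropy, the larger entropy lies between that action's two risks, so
    [lee_abs_sub_between] bounds the gap by one term of the supremum. *)

(** As soon as an argument is infinite, both sides are [+oo]. *)
Lemma abse_subC (R : realDomainType) (x y : \bar R) : `|x - y| = `|y - x|.
Proof. by case: x y => [x| |] [y| |] //=; rewrite distrC. Qed.

(* Infinite arguments are harmless: oo - oo evaluates to -oo, so the right side
   is +oo as soon as x or z is infinite. *)
Lemma lee_abs_sub_between (R : realDomainType) (x y z : \bar R) :
  x <= y -> y <= z -> `|x - y| <= `|x - z|.
Proof.
case: x y z => [x| |] [y| |] [z| |] //=; rewrite ?leey // !lee_fin => xy yz.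
rewrite distrC (distrC x) !ger0_norm ?subr_ge0 ?(le_trans xy) //.
exact: lerB.
Qed.

Theorem theorem7 (R : realType) (d : measure_display) (Z : measurableType d)
    (A : Type) (l : Z -> A -> R) (P Q : probability Z R)
    (expP : forall a : A, has_expectation P (fun z => l z a))
    (expQ : forall a : A, has_expectation Q (fun z => l z a))
    (subPQ : forall a : A,
       'E_P[(fun z => l z a)] +? - 'E_Q[(fun z => l z a)])
    (attP : entropy_attained l P) (attQ : entropy_attained l Q) :
  `|gen_entropy l P - gen_entropy l Q| <= loss_dist l P Q.
Proof.
have entropy_le (P' : probability Z R) a : gen_entropy l P' <= 'E_P'[l^~ a].
  by apply: ereal_inf_lbound; exists a.
have le_dist a : `|'E_P[l^~ a] - 'E_Q[l^~ a]| <= loss_dist l P Q.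
  by apply: ereal_sup_ubound; exists a.
have [PQ|/ltW QP] := leP (gen_entropy l P) (gen_entropy l Q).
  have [a aP] := attP; apply: le_trans (le_dist a).
  by rewrite aP; apply: lee_abs_sub_between.
have [b bQ] := attQ; apply: le_trans (le_dist b).
(* The smaller entropy is now that of [Q]; both differences are flipped to start from it. *)
by rewrite bQ abse_subC [leRHS]abse_subC; apply: lee_abs_sub_between.
Qed.
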